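(* Let $f$ be a ReLU network, $\mathcal{X}\subset\mathbb{R}^{n_0}$ an open set expressible by quadratic or linear constraints, and $\varepsilon\ge0$. Let $(\underline{\mathcal{P}}_1)_\varepsilon$ and the constraint system $(\mathrm{N})$ be as in the context. (a) $(\underline{\mathcal{P}}_1)_\varepsilon$ has the same optimal value as $$\begin{array}{ll}\displaystyle\max_{y,\sigma,x,\nu,\mu}&\sum_{i=1}^{n_L}(2\mu_i-1)(y_L)_i\\ \text{s.t.}&(y,\sigma,x)\text{ satisfies }(\mathrm{N}),\\ &\nu\in\{0,1\}^{n_0},\quad (2\nu_i-1)(y_0)_i\ge0,\ i=1,\dots,n_0,\\ &\sum_{i=1}^{n_0}(2\nu_i-1)(y_0)_i\le1,\\ &\mu\in\{0,1\}^{n_L},\quad (2\mu_i-1)(y_L)_i\ge0,\ i=1,\dots,n_L.\end{array}$$ (b) For every sufficiently large constant $C>0$, $(\underline{\mathcal{P}}_1)_\varepsilon$ has the same optimal value as $$\begin{array}{ll}\displaystyle\max_{y,\sigma,x,u,w,\nu,\mu}&\sum_{i=1}^{n_L}w_i\\ \text{s.t.}&(y,\sigma,x)\text{ satisfies }(\mathrm{N}),\\ &\nu\in\{0,1\}^{n_0},\quad -1\le y_0\le1,\\ &(y_0)_i\le u_i,\quad -(y_0)_i\le u_i,\quad i=1,\dots,n_0,\\ &(y_0)_i\le1-\nu_i,\quad (y_0)_i\ge-\nu_i,\quad i=1,\dots,n_0,\\ &u_i\le-(y_0)_i+2(1-\nu_i),\quad u_i\le(y_0)_i+2\nu_i,\quad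 i=1,\dots,n_0,\\ &\sum_{i=1}^{n_0}u_i\le1,\\ &\mu\in\{0,1\}^{n_L},\\ &(y_L)_i\le w_i,\quad -(y_L)_i\le w_i,\quad i=1,\dots,n_L,\\ &(y_L)_i\le C(1-\mu_i),\quad (y_L)_i\ge-C\mu_i,\quad i=1,\dots,n_L,\\ &w_i\le-(y_L)_i+2C(1-\mu_i),\quad w_i\le(y_L)_i+2C\mu_i,\quad i=1,\dots,n_L,\end{array}$$ where $u\in\mathbb{R}^{n_0}$ and $w\in\mathbb{R}^{n_L}$.
   Context: Network data: $f:\mathbb{R}^{n_0}\to\mathbb{R}^{n_L}$, $f=T_L\circ\rho_{L-1}\circ T_{L-1}\circ\cdots\circ\rho_1\circ T_1$, where $T_k(x)=M_kx+b_k$ maps $\mathbb{R}^{n_{k-1}}$ to $\mathbb{R}^{n_k}$ and $\rho_k$ applies $\mathrm{ReLU}(t)=\max(t,0)$ componentwise. Constraint system $(\mathrm{N})$ in the variables $y=(y_0,\dots,y_L)$, $\sigma=(\sigma_1,\dots,\sigma_{L-1})$, $x=(x_0,\dots,x_{L-1})$ with $y_k,x_k\in\mathbb{R}^{n_k}$: $y_k=M_k\,\mathrm{diag}(\sigma_{k-1})y_{k-1}$ for $k=2,\dots,L$; $y_1=M_1y_0$; $x_k=\sigma_k\odot(M_kx_{k-1}+b_k)$, $(\sigma_k-\tfrac12)\odot(M_kx_{k-1}+b_k)\ge\varepsilon$ and $\sigma_k\in\{0,1\}^{n_k}$ for $k=1,\dots,L-1$; $x_0\in\mathcal{X}$. Problem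 $(\underline{\mathcal{P}}_1)_\varepsilon$: maximize $\|y_L\|_1$ over all $(y,\sigma,x)$ satisfying $(\mathrm{N})$ and $\|y_0\|_1\le1$. $\odot$ is the Hadamard (componentwise) product; $\sigma_k-\tfrac12$ subtracts $\tfrac12$ from each component; vector inequalities (including $-1\le y_0\le 1$) are componentwise; $(v)_i$ is the $i$-th component of $v$. The optimal value of an infeasible maximization problem is $-\infty$. *)

(* Defs.v *)
From HB Require Import structures.
From mathcomp Require Import all_boot all_order all_algebra.
From mathcomp Require Import all_classical all_reals all_analysis.

Set Implicit Arguments.
Unset Strict Implicit.
Unset Printing Implicit Defensive.

Import Order.TTheory GRing.Theory Num.Theory.
Import numFieldNormedType.Exports.

Local Open Scope classical_set_scope.
Local Open Scope ring_scope.

(* The two embeddings of 'I_m into 'I_m.+1: value k, resp. value k.+1. Both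
   equations on values hold by computation, so 'cV_(n (wid k)) is convertible
   to 'cV_(n k) and 'cV_(n (suc k)) to 'cV_(n k.+1). *)
Notation wid k := (widen_ord (leqnSn _) k).
Notation suc k := (lift ord0 k).

Section Vectors.
Variables (R : realType) (m : nat).
Implicit Types u v : 'cV[R]_m.

Definition hadamard u v : 'cV[R]_m := map2_mx *%R u v.

Definition diagc v : 'M[R]_m := diag_mx v^T.

Definition norm1 v : R := \sum_(i < m) `|v i 0|.

Definition binary v : Prop := forall i, v i 0 = 0 \/ v i 0 = 1.

Definition relu v : 'cV[R]_m := map_mx (fun t => Num.max t 0) v.

End Vectors.

(* A network with L = l.+1 affine layers, hence l hidden layers; layer k has
   width n k, and the values of n beyond l.+1 are irrelevant. As ordinals start
   at 0, weight k and bias k are M_(k+1) and b_(k+1). *)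
Record relu_net (R : realType) (l : nat) (n : nat -> nat) := ReluNet {
  weight : forall k : 'I_l.+1, 'M[R]_(n k.+1, n k);
  bias : forall k : 'I_l.+1, 'cV[R]_(n k.+1) }.

Section Network.
Variables (R : realType) (l : nat) (n : nat -> nat) (f : relu_net R l n).

(* T_(k+1) *)
Definition affine (k : 'I_l.+1) (z : 'cV[R]_(n k)) : 'cV[R]_(n k.+1) :=
  weight f k *m z + bias f k.

(* rho_k o T_k o ... o rho_1 o T_1, for k <= l *)
Fixpoint hidden (k : nat) : (k < l.+1)%N -> 'cV[R]_(n 0) -> 'cV[R]_(n k) :=
  match k with
  | 0 => fun _ z => z
  | j.+1 => fun lt_j z =>
      relu (affine (k := Ordinal (ltnW lt_j)) (hidden (ltnW lt_j) z))
  end.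

Definition net_fun (z : 'cV[R]_(n 0)) : 'cV[R]_(n l.+1) :=
  affine (k := ord_max) (hidden (ltnSn l) z).

End Network.

Coercion net_fun : relu_net >-> Funclass.

Section QuadraticSets.
Variables (R : realType) (m : nat).

Inductive constraint_kind := LtZero | LeZero | EqZero.

Definition constraint_holds (c : constraint_kind) (t : R) : Prop :=
  match c with LtZero => t < 0 | LeZero => t <= 0 | EqZero => t = 0 end.

(* linear (affine) constraints are those with Q = 0 *)
Definition quadratic (Q : 'M[R]_m) (c : 'cV[R]_m) (d : R) (z : 'cV[R]_m) : R :=
  (z^T *m Q *m z) 0 0 + (c^T *m z) 0 0 + d.

Definition quadratically_expressible (X : set 'cV[R]_m) : Prop :=
  exists (N : nat) (kind : 'I_N -> constraint_kind)
         (Q : 'I_N -> 'M[R]_m) (c : 'I_N -> 'cV[R]_m) (d : 'I_N -> R),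
    X = [set z | forall j,
           constraint_holds (kind j) (quadratic (Q j) (c j) (d j) z)].

End QuadraticSets.

(* The value is -oo on an empty feasible set. *)
Definition max_value (R : realType) (T : Type) (feasible : set T)
    (objective : T -> R) : \bar R :=
  ereal_sup [set (objective t)%:E | t in feasible].

(* vsigma v k is sigma_(k+1); vy and vx are indexed from 0. *)
Record vars (R : realType) (l : nat) (n : nat -> nat) := Vars {
  vy : forall k : 'I_l.+2, 'cV[R]_(n k);
  vsigma : forall k : 'I_l, 'cV[R]_(n k.+1);
  vx : forall k : 'I_l.+1, 'cV[R]_(n k) }.

Definition y_in (R : realType) (l : nat) (n : nat -> nat) (v : vars R l n) :
  'cV[R]_(n 0) := vy v ord0.

Definition y_out (R : realType) (l : nat) (n : nat -> nat) (v : vars R l n) :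
  'cV[R]_(n l.+1) := vy v ord_max.

Record vars_a (R : realType) (l : nat) (n : nat -> nat) := VarsA {
  vars_of_a :> vars R l n;
  nu_a : 'cV[R]_(n 0);
  mu_a : 'cV[R]_(n l.+1) }.

Record vars_b (R : realType) (l : nat) (n : nat -> nat) := VarsB {
  vars_of_b :> vars R l n;
  u_b : 'cV[R]_(n 0);
  w_b : 'cV[R]_(n l.+1);
  nu_b : 'cV[R]_(n 0);
  mu_b : 'cV[R]_(n l.+1) }.

Section Problems.
Variables (R : realType) (l : nat) (n : nat -> nat) (f : relu_net R l n).
Variables (X : set 'cV[R]_(n 0)) (eps : R).

Record system_N (v : vars R l n) : Prop := SystemN {
  N_y : forall k : 'I_l,
    vy v (suc (suc k)) =
      weight f (suc k) *m diagc (vsigma v k) *m vy v (suc (wid k));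
  N_y1 : vy v (suc ord0) = weight f ord0 *m vy v ord0;
  N_x : forall k : 'I_l,
    vx v (suc k) = hadamard (vsigma v k) (affine f (vx v (wid k)));
  N_eps : forall (k : 'I_l) (i : 'I_(n k.+1)),
    eps <= hadamard (vsigma v k - const_mx 2^-1) (affine f (vx v (wid k))) i 0;
  N_sigma : forall k : 'I_l, binary (vsigma v k);
  N_x0 : X (vx v ord0) }.

Definition P1_value : \bar R :=
  max_value [set v : vars R l n | system_N v /\ norm1 (y_in v) <= 1]
            (fun v => norm1 (y_out v)).

Record feasible_a (v : vars_a R l n) : Prop := FeasibleA {
  a_N : system_N v;
  a_nu : binary (nu_a v);
  a_nu_sign : forall i, 0 <= (2 * nu_a v i 0 - 1) * y_in v i 0;
  a_nu_sum : \sum_(i < n 0) (2 * nu_a v i 0 - 1) * y_in v i 0 <= 1;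
  a_mu : binary (mu_a v);
  a_mu_sign : forall i, 0 <= (2 * mu_a v i 0 - 1) * y_out v i 0 }.

Definition Pa_value : \bar R :=
  max_value [set v : vars_a R l n | feasible_a v]
            (fun v => \sum_(i < n l.+1) (2 * mu_a v i 0 - 1) * y_out v i 0).

Record feasible_b (C : R) (v : vars_b R l n) : Prop := FeasibleB {
  b_N : system_N v;
  b_nu : binary (nu_b v);
  b_y0 : forall i, -1 <= y_in v i 0 <= 1;
  b_u_ge : forall i, y_in v i 0 <= u_b v i 0 /\ - y_in v i 0 <= u_b v i 0;
  b_nu_y0 : forall i,
    y_in v i 0 <= 1 - nu_b v i 0 /\ y_in v i 0 >= - nu_b v i 0;
  b_u_le : forall i,
    u_b v i 0 <= - y_in v i 0 + 2 * (1 - nu_b v i 0) /\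
    u_b v i 0 <= y_in v i 0 + 2 * nu_b v i 0;
  b_u_sum : \sum_(i < n 0) u_b v i 0 <= 1;
  b_mu : binary (mu_b v);
  b_w_ge : forall i, y_out v i 0 <= w_b v i 0 /\ - y_out v i 0 <= w_b v i 0;
  b_mu_yL : forall i,
    y_out v i 0 <= C * (1 - mu_b v i 0) /\ y_out v i 0 >= - C * mu_b v i 0;
  b_w_le : forall i,
    w_b v i 0 <= - y_out v i 0 + 2 * C * (1 - mu_b v i 0) /\
    w_b v i 0 <= y_out v i 0 + 2 * C * mu_b v i 0 }.

Definition Pb_value (C : R) : \bar R :=
  max_value [set v : vars_b R l n | feasible_b C v]
            (fun v => \sum_(i < n l.+1) w_b v i 0).

End Problems.

(* Main.v *)
Require Import Defs.
From HB Require Import structures.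
From mathcomp Require Import all_boot all_order all_algebra.
From mathcomp Require Import all_classical all_reals all_analysis.
From mathcomp Require Import lra.

Set Implicit Arguments.
Unset Strict Implicit.
Unset Printing Implicit Defensive.

Import Order.TTheory GRing.Theory Num.Theory.
Import numFieldNormedType.Exports.

Local Open Scope classical_set_scope.
Local Open Scope ring_scope.

(** Each reformulation attains exactly the same objective values as the
    original problem, so the suprema agree. A feasible point of a reformulation
    restricts to its [(y, sigma, x)] part, and a feasible [(y, sigma, x)]
    extends by reading the extra variables off [y_0] and [y_L].

    In (a), a binary [s] with [0 <= (2 s - 1) t] selects the sign of [t], so
    that [(2 s - 1) t] is the absolute value of [t] ([signbit_normE]). In (b),
    the linear constraints around a binary [s] are a big-M linearisation: they
    say that [w] is the absolute value of [t] and that this value is at most [C]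
    ([bigM_normE], [bigM_indicator]). For the input the constant 1 is enough,
    since the entries of a vector of 1-norm at most 1 are at most 1 in absolute
    value. For the output, [C] has to bound the entries of every feasible
    [y_L]; such a bound depends on the network only, because [y_L] is obtained
    from [y_0] by the fixed weight matrices and by 0/1 diagonal matrices, which
    do not increase the 1-norm ([norm1_y_bounded]). *)

(** Matching objective values suffices, so infeasible problems and unattained
    suprema need no separate treatment. *)
Lemma max_value_eq (R : realType) (S T : Type) (A : set S) (B : set T)
    (f : S -> R) (g : T -> R) :
  (forall s, A s -> exists2 t, B t & g t = f s) ->
  (forall t, B t -> exists2 s, A s & f s = g t) ->
  max_value A f = max_value B g.
Proof.
move=> AB BA; congr ereal_sup; apply/seteqP; split=> _ [z Dz <-].
  by have [t Bt <-] := AB _ Dz; exists t.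
by have [s As <-] := BA _ Dz; exists s.
Qed.

Section Scalars.
Variable R : realType.
Implicit Types s t w C : R.

Lemma signbit_normE s t :
  s = 0 \/ s = 1 -> 0 <= (2 * s - 1) * t -> (2 * s - 1) * t = `|t|.
Proof. by case=> ->; have [] := ger0P t => ? ?; lra. Qed.

Lemma signbit_ge0_norm t : (2 * (0 <= t)%R%:R - 1) * t = `|t|.
Proof. by have [] := ger0P t => ? /=; lra. Qed.

(** For [s = 0] the constraints amount to [0 <= t <= C] and [w = t], for [s = 1]
    to [- C <= t <= 0] and [w = - t]; the other inequalities follow from these. *)
Definition bigM C s t w : Prop :=
  [/\ t <= w /\ - t <= w,
      t <= C * (1 - s) /\ t >= - C * s
    & w <= - t + 2 * C * (1 - s) /\ w <= t + 2 * C * s].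

Lemma bigM_normE C s t w : s = 0 \/ s = 1 -> bigM C s t w -> w = `|t|.
Proof.
by case=> -> [[? ?] [? ?] [? ?]]; have [] := ger0P t => ?; lra.
Qed.

Lemma bigM_indicator C t : `|t| <= C -> bigM C (t < 0)%R%:R t `|t|.
Proof. by have [] := ger0P t => ? ? /=; do !split; lra. Qed.

Lemma boolr01 (b : bool) : b%:R = 0 :> R \/ b%:R = 1 :> R.
Proof. by case: b; [right | left]. Qed.

End Scalars.

Section Norm1.
Variables (R : realType) (m : nat).
Implicit Types v s : 'cV[R]_m.

Lemma ler_entry_norm1 v i : `|v i 0| <= norm1 v.
Proof. by rewrite /norm1 (bigD1 i) //= lerDl sumr_ge0. Qed.

Lemma norm1_mulmx_le p (M : 'M[R]_(p, m)) v :
  norm1 (M *m v) <= (\sum_i \sum_j `|M i j|) * norm1 v.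
Proof.
rewrite [leLHS]/norm1 mulr_suml; apply: ler_sum => i _.
rewrite mxE mulr_suml; apply: le_trans (ler_norm_sum _ _ _) _.
by apply: ler_sum => j _; rewrite normrM ler_wpM2l ?ler_entry_norm1.
Qed.

Lemma norm1_diagc_le s v : binary s -> norm1 (diagc s *m v) <= norm1 v.
Proof.
move=> s01; apply: ler_sum => i _; rewrite /diagc mul_diag_mx !mxE.
by case: (s01 i) => ->; rewrite ?mul1r ?mul0r ?normr0.
Qed.

End Norm1.

Section Bound.
Variables (R : realType) (l : nat) (n : nat -> nat) (f : relu_net R l n).
Variables (X : set 'cV[R]_(n 0)) (eps : R).

(** Stating the bound for one layer as a predicate of its index makes it
    possible to rewrite with equations between ordinals, although the type of
    [vy v k] depends on [k]. *)
Definition y_bounded (k : 'I_l.+2) : Prop :=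
  exists B : R, forall v : vars R l n,
    system_N f X eps v -> norm1 (y_in v) <= 1 -> norm1 (vy v k) <= B.

(** One affine layer multiplies the bound by the sum of the absolute values of
    its weights, whatever the activation pattern. *)
Lemma y_bounded_step (k : 'I_l) :
  y_bounded (suc (wid k)) -> y_bounded (suc (suc k)).
Proof.
case=> B yB; exists ((\sum_i \sum_j `|weight f (suc k) i j|) * B) => v Nv v1.
rewrite (N_y Nv) -mulmxA; apply: le_trans (norm1_mulmx_le _ _) _.
apply: ler_wpM2l; first by apply: sumr_ge0 => i _; exact: sumr_ge0.
by apply: le_trans (yB v Nv v1); apply: norm1_diagc_le; exact: (N_sigma Nv).
Qed.

Lemma norm1_y_bounded (k : 'I_l.+2) : y_bounded k.
Proof.
case: k => k; elim: k => [|[|k] IH] ltk.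
- have -> : Ordinal ltk = ord0 by exact: val_inj.
  by exists 1.
- have -> : Ordinal ltk = suc ord0 by exact: val_inj.
  exists (\sum_i \sum_j `|weight f ord0 i j|) => v Nv v1.
  rewrite (N_y1 Nv); apply: le_trans (norm1_mulmx_le _ _) _.
  by apply: ler_piMr => //; apply: sumr_ge0 => i _; exact: sumr_ge0.
- have lek : (k < l)%N by [].
  have -> : Ordinal ltk = suc (suc (Ordinal lek)) by exact: val_inj.
  apply: y_bounded_step.
  have -> : suc (wid (Ordinal lek)) = Ordinal (ltnW ltk) by exact: val_inj.
  exact: IH.
Qed.

Lemma P1_value_eq_Pa : P1_value f X eps = Pa_value f X eps.
Proof.
apply: max_value_eq => [v [Nv v1]|v [Nv nu01 nuS nu1 mu01 muS]].
  exists (VarsA v (\col_i (0 <= y_in v i 0)%R%:R)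
                  (\col_i (0 <= y_out v i 0)%R%:R)) => /=; last first.
    by apply: eq_bigr => i _; rewrite mxE signbit_ge0_norm.
  split=> //= [i|i||i|i]; rewrite ?mxE ?signbit_ge0_norm //;
    try exact: boolr01.
  by under eq_bigr => i _ do rewrite mxE signbit_ge0_norm.
exists (vars_of_a v); first split=> //.
  rewrite /norm1.
  by under eq_bigr => i _ do rewrite -(signbit_normE (nu01 i) (nuS i)).
by apply: eq_bigr => i _; rewrite (signbit_normE (mu01 i) (muS i)).
Qed.

(** The bound on [norm1 (y_out v)] keeps the constraints with [C] from cutting
    off points of the original problem. *)
Lemma P1_value_eq_Pb (C : R) :
  (forall v : vars R l n, system_N f X eps v -> norm1 (y_in v) <= 1 ->
     norm1 (y_out v) <= C) ->
  P1_value f X eps = Pb_value f X eps C.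
Proof.
move=> yC; apply: max_value_eq => [v [Nv v1]|v].
  (* The input constraints are the big-M constraints with constant 1. *)
  have in1 i : `|y_in v i 0| <= 1 := le_trans (ler_entry_norm1 _ i) v1.
  have bin i := bigM_indicator (in1 i).
  have bout i :=
    bigM_indicator (le_trans (ler_entry_norm1 (y_out v) i) (yC v Nv v1)).
  exists (VarsB v (\col_i `|y_in v i 0|) (\col_i `|y_out v i 0|)
                  (\col_i (y_in v i 0 < 0)%R%:R)
                  (\col_i (y_out v i 0 < 0)%R%:R)) => /=; last first.
    by apply: eq_bigr => i _; rewrite mxE.
  split=> //= [i|i|i|i|i||i|i|i|i]; rewrite ?mxE; try exact: boolr01.
  - by rewrite -ler_norml.
  - by case: (bin i).
  - by case: (bin i) => _; rewrite mul1r mulN1r.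
  - by case: (bin i) => _ _; rewrite mulr1.
  - by under eq_bigr => i _ do rewrite mxE.
  - by case: (bout i).
  - by case: (bout i).
  - by case: (bout i).
case=> Nv nu01 _ uge nuy ule u1 mu01 wge muy wle.
exists (vars_of_b v); last first.
  apply: eq_bigr => i _; apply/esym/(bigM_normE (mu01 i)).
  by split; [exact: wge | exact: muy | exact: wle].
split=> //; apply: le_trans u1; apply: ler_sum => i _.
rewrite (bigM_normE (C := 1) (nu01 i) (t := y_in v i 0) (w := u_b v i 0)) //.
by split; [exact: uge | rewrite mul1r mulN1r; exact: nuy
                      | rewrite mulr1; exact: ule].
Qed.

End Bound.

Theorem mainTheorem5 (R : realType) (l : nat) (n : nat -> nat)
    (f : relu_net R l n) (X : set 'cV[R]_(n 0%N)) (eps : R) :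
  open X -> quadratically_expressible X -> 0 <= eps ->
  P1_value f X eps = Pa_value f X eps /\
  exists C0 : R, 0 < C0 /\
    forall C : R, C0 <= C -> P1_value f X eps = Pb_value f X eps C.
Proof.
move=> _ _ _; split; first exact: P1_value_eq_Pa.
have [B yB] := norm1_y_bounded f X eps ord_max.
(* The maximum with 1 makes the threshold positive. *)
exists (Num.max B 1); split=> [|C]; first by rewrite lt_max ltr01 orbT.
rewrite ge_max => /andP[BC _]; apply: P1_value_eq_Pb => v Nv v1.
exact: le_trans (yB v Nv v1) BC.
Qed.
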